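(* For every positive integer $g$ there exist star-shaped sets 1) $X\subset\mathbb{R}^5$ satisfying $\chi(X)=2$ and $\gamma(X)\ge g$, and 2) $X_c\subset\mathbb{R}^5$ that is closed and satisfies $\chi(X_c)\le 6$ and $\gamma(X_c)\ge g$.
   Context: For $X\subseteq\mathbb{R}^d$, two points $x,y\in X$ see each other (within $X$) if the straight-line segment $\overline{xy}$ is a subset of $X$. The invisibility graph $I(X)$ is the (possibly infinite) graph with vertex set $X$ in which two points are adjacent if and only if they do not see each other. $\chi(X)$ is the chromatic number of $I(X)$. The convexity number $\gamma(X)$ is the minimum number of convex subsets of $X$ whose union is $X$ (possibly infinite). A set $X$ is star-shaped if it contains a point that sees every other point of $X$. *)

(* Defs.v *)
From HB Require Import structures.
From mathcomp Require Import all_boot all_order all_algebra.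
From mathcomp Require Import all_classical all_reals all_analysis.

Set Implicit Arguments.
Unset Strict Implicit.
Unset Printing Implicit Defensive.

Import Order.TTheory GRing.Theory Num.Theory.
Import numFieldNormedType.Exports.

Local Open Scope classical_set_scope.
Local Open Scope ring_scope.
Local Open Scope convex_scope.

(* Minimum of a set of natural numbers, as an extended real: a nonempty set of
   naturals attains its infimum, and the infimum of the empty set is +oo. *)
Definition enat_min (R : realType) (S : set nat) : \bar R :=
  ereal_inf [set n%:R%:E | n in S].

Definition colorable (V : Type) (adj : V -> V -> Prop) (n : nat) : Prop :=
  exists c : V -> 'I_n, forall x y : V, adj x y -> c x <> c y.

Definition chromatic_number (R : realType) (V : Type) (adj : V -> V -> Prop)
    : \bar R :=
  enat_min R [set n | colorable adj n].

Section Visibility.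
Context {R : realType} {d : nat}.
Implicit Types (X : set 'rV[R]_d) (x y : 'rV[R]_d).

Definition segment x y : set 'rV[R]_d :=
  [set (x : convex_lmodType 'rV[R]_d) <| t |> y | t in [set: {i01 R}]].

Definition sees X x y : Prop := segment x y `<=` X.

(* The vertex type is the subtype of points of X. There are no loops, since
   segment x x = [set x]. *)
Definition invisibility_graph X (x y : X) : Prop :=
  ~ sees X (set_val x) (set_val y).

Definition chi X : \bar R := chromatic_number R (@invisibility_graph X).

Definition convex_cover X (n : nat) : Prop :=
  exists F : 'I_n -> set 'rV[R]_d,
    [/\ forall i, F i `<=` X,
        forall i, convex_set (F i : set (convex_lmodType 'rV[R]_d)) &
        \bigcup_i F i = X].

Definition convexity_number X : \bar R := enat_min R [set n | convex_cover X n].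

Definition star_shaped X : Prop :=
  exists2 p, X p & forall y, X y -> y <> p -> sees X p y.

End Visibility.

(* Main.v *)
Require Import Defs.
From mathcomp Require Import all_boot all_order all_algebra.
From mathcomp Require Import all_classical all_reals all_analysis.
From mathcomp Require Import ring lra zify.
Import Order.TTheory GRing.Theory Num.Theory.
Import numFieldNormedType.Exports.

Set Implicit Arguments.
Unset Strict Implicit.
Unset Printing Implicit Defensive.

(** The Veronese map (a, b) |-> (a, b, a^2, ab, b^2) turns products of two
    affine forms of the plane into affine functions on R^5.  If an affine form
    vanishes exactly on a line, its square is thus an affine function that
    supports the convex hull K of a lifted finite plane set exactly along the
    lifted points of this line: every line of the plane becomes a face of K, and
    two lines share at most one vertex.

    By the Hales-Jewett theorem ([hales_jewett3]) there is a finite plane set,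
    with finitely many lines carrying three of its points each, such that every
    colouring of the points with g colours leaves one of the lines monochromatic
    ([lines_on_veronese_ramsey]).  Each line gives a triangular face of K.  If X
    is K with the centre of every one of these triangles removed, a cover of X by
    fewer than g convex subsets colours the vertices, and a monochromatic line
    forces the centre of its triangle into a convex piece, a contradiction
    ([convexity_number_ge]).

    The invisibility graph, on the contrary, only sees one face at a time.  Two
    points that do not see each other lie on the same triangle, in opposite
    directions from its centre.  On one triangle an odd sign function of these
    directions separates such pairs, and this function is positive at the
    vertices, the only points that belong to several triangles; hence two
    colours ([punctured_colorable]).

    For a closed set, each centre is removed together with an open dent: the
    region where three affine functions [dent L i] are positive.  The i-th of
    them is, on the triangle, the i-th barycentric coordinate minus 1/4, and
    decreases so steeply with the height above the face that the dent is a very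
    shallow pyramid.  The points of K at which, for one fixed i, no [dent L i] is
    positive form a convex subset of the dented set: three colours.  The
    remaining points are low above two different faces, hence close to a vertex
    of K; two such points always see each other, so that a fourth colour is
    enough ([dented_colorable]).

    Both sets are star-shaped around a point of K that is high above every face;
    an additional vertex of K, the apex, plays this role. *)

(** * The Hales-Jewett theorem over three letters *)

Notation o0 := (ord0 : 'I_3).
Notation o1 := (Ordinal (isT : (1 < 3)%N)).
Notation o2 := (Ordinal (isT : (2 < 3)%N)).

Lemma letterP (P : 'I_3 -> Prop) : P o0 -> P o1 -> P o2 -> forall x, P x.
Proof.
move=> P0 P1 P2 [[|[|[|//]]] i_lt]; [move: P0|move: P1|move: P2];
by congr P; apply: val_inj.
Qed.

(** A template over three letters is a word in which some entries, the stars
    [None], are left open; it describes a combinatorial line, obtained by putting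
    the same letter at all the stars. *)
Definition fill (x : 'I_3) (t : seq (option 'I_3)) : seq 'I_3 :=
  [seq odflt x e | e <- t].

Lemma fill_cat x s t : fill x (s ++ t) = fill x s ++ fill x t.
Proof. exact: map_cat. Qed.

Lemma fill_nseq x n e : fill x (nseq n e) = nseq n (odflt x e).
Proof. exact: map_nseq. Qed.

Lemma pigeonhole_nat (C : finType) (f : nat -> C) :
  exists a b, [/\ (a < b)%N, (b <= #|C|)%N & f a = f b].
Proof.
pose h (i : 'I_#|C|.+1) := f i.
have /injectivePn[i [j nij hij]] : ~~ injectiveb h.
  apply/negP => /injectiveP /leq_card; by rewrite card_ord ltnn.
case: (ltngtP i j) => [ltij|ltji|/val_inj eij]; last by rewrite eij eqxx in nij.
- by exists i, j; split; rewrite // -ltnS.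
- by exists j, i; split; rewrite // -ltnS.
Qed.

(** Pigeonhole on the words 2^j 1^(N-j): two of them with the same colour differ
    in a block of consecutive positions, which becomes the block of stars. *)
Lemma two_letter_line (C : finType) :
  exists N, forall c : seq 'I_3 -> C, exists t,
    [/\ size t = N, None \in t & c (fill o1 t) = c (fill o2 t)].
Proof.
exists #|C| => c.
have [a [b [ltab leb eqc]]] :=
  pigeonhole_nat (fun j => c (nseq j o2 ++ nseq (#|C| - j) o1)).
exists (nseq a (Some o2) ++ nseq (b - a) None ++ nseq (#|C| - b) (Some o1)).
split.
- by rewrite !size_cat !size_nseq addnA subnKC ?subnKC // ltnW.
- by rewrite !mem_cat !mem_nseq subn_gt0 ltab /= orbT.
- rewrite !fill_cat !fill_nseq /= -nseqD [in RHS]catA -nseqD.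
  have -> : b - a + (#|C| - b) = #|C| - a by lia.
  by have -> : a + (b - a) = b by lia.
Qed.

Definition apply_blocks (ts : seq (seq (option 'I_3))) (xs : seq 'I_3) :=
  flatten [seq fill p.2 p.1 | p <- zip ts xs].

Lemma size_apply_blocks ts xs :
  size ts = size xs -> size (apply_blocks ts xs) = size (flatten ts).
Proof.
elim: ts xs => [|t ts IH] [|x xs] //= [eqs].
by rewrite /apply_blocks /= !size_cat size_map; congr addn; apply: IH.
Qed.

(** The heart of Shelah's proof of the Hales-Jewett theorem: m templates in a row
    span an m-dimensional space of words on which the colouring does not
    distinguish the letters 1 and 2.  The first template is found by colouring
    its words with the functions that they induce on all the continuations; the
    others by colouring their words with the three values obtained from the
    three fillings of the first. *)
Lemma insensitive_blocks m (C : finType) :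
  exists N, forall c : seq 'I_3 -> C, exists ts,
    [/\ size ts = m, all (fun t => None \in t) ts, size (flatten ts) = N &
      forall xs ys, size xs = m -> size ys = m ->
        [seq x == o0 | x <- xs] = [seq y == o0 | y <- ys] ->
        c (apply_blocks ts xs) = c (apply_blocks ts ys)].
Proof.
elim: m C => [|m IH] C; first by exists 0 => c; exists [::]; split=> // -[] // [].
have [N2 HN2] := IH {ffun 'I_3 -> C}.
have [N1 HN1] := two_letter_line {ffun N2.-tuple 'I_3 -> C}.
exists (N1 + N2) => c.
have [t [szt Nt ct]] :=
  HN1 (fun u => [ffun v : N2.-tuple 'I_3 => c (u ++ tval v)]).
have [ts [szts Nts sz2 cts]] := HN2 (fun v => [ffun x => c (fill x t ++ v)]).
exists (t :: ts); split => //=; first by rewrite szts.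
- by rewrite Nt.
- by rewrite size_cat szt sz2.
move=> [//|x xs] [//|y ys] [szx] [szy] [exy exys].
rewrite /apply_blocks /= -!/(apply_blocks _ _).
have /ffunP/(_ x) := cts _ _ szx szy exys; rewrite !ffunE => ->.
have szv : size (apply_blocks ts ys) == N2.
  by rewrite size_apply_blocks ?sz2 // szts szy.
have /ffunP/(_ (Tuple szv)) := ct; rewrite !ffunE /=.
by elim/letterP: x exy; elim/letterP: y.
Qed.

(** In the space of words given by [insensitive_blocks], where 2 behaves as 1, it
    remains to find a line on which the letters 0 and 1 have the same colour,
    and this is again a pigeonhole, on the words 1^j 0^(m-j). *)
Theorem hales_jewett3 (C : finType) :
  exists N, forall c : seq 'I_3 -> C, exists t,
    [/\ size t = N, None \in t & forall x y, c (fill x t) = c (fill y t)].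
Proof.
have [N HN] := insensitive_blocks #|C| C.
exists N => c; have [ts [szts Nts szf cts]] := HN c.
have [a [b [ltab leb eqc]]] := pigeonhole_nat
  (fun j => c (apply_blocks ts (nseq j o1 ++ nseq (#|C| - j) o0))).
pose os := nseq a (Some o1) ++ nseq (b - a) None ++ nseq (#|C| - b) (Some o0).
have szos : size os = #|C|.
  by rewrite !size_cat !size_nseq addnA subnKC ?subnKC // ltnW.
have Nos : None \in os by rewrite !mem_cat !mem_nseq subn_gt0 ltab /= orbT.
(* The star of a block in [os] leaves the stars of that block open. *)
pose plug (p : seq (option 'I_3) * option 'I_3) :=
  [seq if e is None then p.2 else e | e <- p.1].
pose t := flatten [seq plug p | p <- zip ts os].
have fillt x : fill x t = apply_blocks ts (fill x os).
  rewrite /t /fill; elim: (ts) (os) => [|u us IH] [|o os'] //=.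
  rewrite /apply_blocks /= map_cat; congr cat; last exact: IH.
  by rewrite /fill /plug -map_comp; apply: eq_map => -[].
have eqf : forall x, c (fill x t) = c (fill o1 t).
  elim/letterP => //.
  - rewrite !fillt /os !fill_cat !fill_nseq /= -nseqD [in RHS]catA -nseqD.
    have -> : b - a + (#|C| - b) = #|C| - a by lia.
    by have -> : a + (b - a) = b by lia.
  - rewrite !fillt; apply: cts; rewrite ?size_map //.
    by rewrite -!map_comp /os !map_cat !map_nseq.
exists t; split; last by move=> x y; rewrite (eqf x) (eqf y).
- have -> : size t = size (fill o0 t) by rewrite size_map.
  by rewrite fillt size_apply_blocks ?szf // size_map szts szos.
- have {}szos : size ts = size os by rewrite szts szos.
  rewrite /t; elim: (ts) (os) szos Nts Nos => [|u us IH] [|o os'] //= [eqs].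
  case/andP=> Nu Nus; rewrite inE => No; rewrite mem_cat; apply/orP.
  case/orP: No => [/eqP <-|No]; last by right; apply: IH.
  by left; apply/mapP; exists None.
Qed.

(** * Affine functions and convex hulls *)

Local Open Scope classical_set_scope.
Local Open Scope ring_scope.

Lemma sum3 (V : nmodType) (F : 'I_3 -> V) :
  \sum_i F i = F o0 + F o1 + F o2.
Proof.
rewrite !big_ord_recr big_ord0 /= add0r.
by congr (F _ + F _ + F _); apply: val_inj.
Qed.

Section EnatMin.
Context {R : realType}.
Implicit Types (S : set nat) (n : nat).

Lemma enat_min_ge S n :
  (forall m, S m -> (n <= m)%N) -> (n%:R%:E <= enat_min R S)%E.
Proof.
move=> Sn; apply: le_ereal_inf_tmp => _ [m Sm <-].
by rewrite lee_fin ler_nat Sn.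
Qed.

Lemma enat_min_le S n : S n -> (enat_min R S <= n%:R%:E)%E.
Proof. by move=> Sn; apply: ereal_inf_lbound; exists n. Qed.

End EnatMin.

Section Affine.
Context {R : realType} {d : nat}.
Implicit Types (x y : 'rV[R]_d) (f g : 'rV[R]_d -> R) (X : set 'rV[R]_d).

Lemma seesE X x y :
  sees X x y <-> forall t, 0 <= t -> t <= 1 -> X (t *: x + (1 - t) *: y).
Proof.
split=> [Xxy t t0 t1|Xxy _ [t _ <-]]; first by apply: Xxy; exists (Itv01 t0 t1).
by apply: Xxy; [exact: ge0|exact: le1].
Qed.

Lemma convex_setE X :
  convex_set (X : set (convex_lmodType 'rV[R]_d)) <->
  forall x y, X x -> X y -> sees X x y.
Proof.
split=> [Xc x y Xx Xy _ [t _ <-]|Xc x y t].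
  by apply/set_mem/Xc; apply/mem_set.
by move=> /set_mem Xx /set_mem Xy; apply/mem_set/(Xc x y) => //; exists t.
Qed.

Definition barycentre3 (v : 'I_3 -> 'rV[R]_d) := 3^-1 *: \sum_i v i.

Lemma barycentre3_convex X (v : 'I_3 -> 'rV[R]_d) :
  convex_set (X : set (convex_lmodType 'rV[R]_d)) -> (forall i, X (v i)) ->
  X (barycentre3 v).
Proof.
move=> /convex_setE Xc Xv.
have h0 : (0 : R) <= 2^-1 by lra.
have h1 : (2^-1 : R) <= 1 by lra.
have t0 : (0 : R) <= 3^-1 by lra.
have t1 : (3^-1 : R) <= 1 by lra.
have Xm := (seesE X (v o1) (v o2)).1 (Xc _ _ (Xv o1) (Xv o2)) _ h0 h1.
have := (seesE X (v o0) _).1 (Xc _ _ (Xv o0) Xm) _ t0 t1.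
congr X; rewrite /barycentre3 sum3.
by apply/rowP => k; rewrite !mxE; field.
Qed.

Definition affine f :=
  exists a (u : 'cV[R]_d), forall x, f x = a + (x *m u) 0 0.

Lemma affine_cst a : affine (fun=> a).
Proof. by exists a, 0 => x; rewrite mulmx0 mxE addr0. Qed.

Lemma affineD f g : affine f -> affine g -> affine (fun x => f x + g x).
Proof.
move=> [a [u fE]] [b [v gE]]; exists (a + b), (u + v) => x.
by rewrite fE gE mulmxDr [in RHS]mxE addrACA.
Qed.

Lemma affineZ c f : affine f -> affine (fun x => c * f x).
Proof.
move=> [a [u fE]]; exists (c * a), (c *: u) => x.
by rewrite fE mulrDr -scalemxAr [in RHS]mxE.
Qed.

Lemma affineN f : affine f -> affine (fun x => - f x).
Proof.
move=> [a [u fE]]; exists (- a), (- u) => x.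
by rewrite fE mulmxN [in RHS]mxE opprD.
Qed.

Lemma affineB f g : affine f -> affine g -> affine (fun x => f x - g x).
Proof. by move=> /affineD fa /affineN; apply: fa. Qed.

Lemma affine_sum (I : finType) (F : I -> 'rV[R]_d -> R) :
  (forall i, affine (F i)) -> affine (fun x => \sum_i F i x).
Proof.
move=> /choice[a /choice[u FE]]; exists (\sum_i a i), (\sum_i u i) => x.
by rewrite mulmx_sumr summxE -big_split; apply: eq_bigr => i _; rewrite FE.
Qed.

Lemma affine_coord k : affine (fun x => x 0 k).
Proof.
exists 0, (delta_mx k 0) => x; rewrite add0r mxE (bigD1 k) //=.
rewrite mxE !eqxx mulr1 big1 ?addr0 // => j jk.
by rewrite mxE (negbTE jk) mulr0.
Qed.

Lemma affine_mix f t x y :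
  affine f -> f (t *: x + (1 - t) *: y) = t * f x + (1 - t) * f y.
Proof.
move=> [a [u fE]]; rewrite !fE mulmxDl -!scalemxAl.
by move: (x *m u) (y *m u) => p q; rewrite !mxE; ring.
Qed.

Lemma affine_barycentre3 f (v : 'I_3 -> 'rV[R]_d) :
  affine f -> f (barycentre3 v) = 3^-1 * \sum_i f (v i).
Proof.
move=> [a [u fE]]; rewrite fE /barycentre3 !sum3 !fE -scalemxAl !mulmxDl.
by move: (v o0 *m u) (v o1 *m u) (v o2 *m u) => p q r; rewrite !mxE; field.
Qed.

Lemma affine_continuous f : affine f -> continuous f.
Proof.
move=> [a [u fE]]; rewrite (_ : f = cst a \+ fun x => \sum_j x 0 j * u j 0).
  move=> x; apply: continuousD; first exact: cst_continuous.
  apply: continuous_big => [|j _ y]; first exact: add_continuous.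
  have cu : {for y, continuous (cst (u j 0) : 'rV[R]_d -> R)}.
    exact: cst_continuous.
  exact: (continuousM (@coord_continuous R 1 d 0 j y) cu).
by apply/funext => x; rewrite fE mxE.
Qed.

Lemma closed_affine_ge0 f : affine f -> closed [set x | 0 <= f x].
Proof.
move=> fa; apply: (@preimage_closed _ _ f [set r | 0 <= r]) => [x _|].
  exact: affine_continuous.
exact: closed_ge.
Qed.

Lemma convex_affine_ge0 f : affine f ->
  convex_set ([set x | 0 <= f x] : set (convex_lmodType 'rV[R]_d)).
Proof.
move=> fa; apply/convex_setE => x y /= fx fy; apply/seesE => t t0 t1 /=.
by rewrite affine_mix // addr_ge0 // mulr_ge0 // subr_ge0.
Qed.

Section Hull.
Context {P : finType} (pos : P -> 'rV[R]_d).

(** The convex hull of a finite family in its dual form: the points that satisfy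
    every affine inequality valid at the points of the family.  Closedness and
    convexity are then immediate, and an inequality on the hull is proved by
    checking it on the family. *)
Definition hull : set 'rV[R]_d :=
  [set x | forall f, affine f -> (forall w, 0 <= f (pos w)) -> 0 <= f x].

Lemma pos_hull w : hull (pos w).
Proof. by move=> f _; apply. Qed.

Lemma hull_closed : closed hull.
Proof.
pose valid f := affine f /\ forall w, 0 <= f (pos w).
rewrite (_ : hull = \bigcap_(f in valid) [set x | 0 <= f x]).
  by apply: closed_bigI => f [fa _]; exact: closed_affine_ge0.
by apply/seteqP; split=> x Kx f; [move=> []; exact: Kx|move=> ? ?; exact: Kx].
Qed.

Lemma hull_convex : convex_set (hull : set (convex_lmodType 'rV[R]_d)).
Proof.
apply/convex_setE => x y Kx Ky z xyz f fa f0.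
have /convex_setE := convex_affine_ge0 fa.
by move=> /(_ x y (Kx f fa f0) (Ky f fa f0) z xyz).
Qed.

Lemma hull_le f g x : affine f -> affine g ->
  (forall w, f (pos w) <= g (pos w)) -> hull x -> f x <= g x.
Proof.
move=> fa ga fg /(_ _ (affineB ga fa)); rewrite subr_ge0; apply => w.
by rewrite subr_ge0.
Qed.

(** On the face of the hull where h vanishes, an affine inequality has to be
    checked only at the vertices of this face: elsewhere a large multiple of h
    makes it true, and this multiple contributes nothing on the face. *)
Lemma hull_face_ge0 h f x : affine h -> affine f ->
  (forall w, 0 <= h (pos w)) -> (forall w, h (pos w) = 0 -> 0 <= f (pos w)) ->
  hull x -> h x = 0 -> 0 <= f x.
Proof.
move=> ha fa h0 f0 Kx hx.
pose C := \sum_w `|f (pos w)| / h (pos w).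
have := Kx _ (affineD fa (affineZ C ha)); rewrite hx mulr0 addr0; apply => w.
have [hw0|hw0] := eqVneq (h (pos w)) 0; first by rewrite hw0 mulr0 addr0 f0.
have hw : 0 < h (pos w) by rewrite lt_def hw0 h0.
have : `|f (pos w)| / h (pos w) <= C.
  rewrite /C (bigD1 w) //= lerDl sumr_ge0 // => j _.
  by rewrite divr_ge0.
rewrite ler_pdivrMr // => fC.
by have := ler_norm (- f (pos w)); rewrite normrN; lra.
Qed.

Lemma hull_face_eq0 h f x : affine h -> affine f ->
  (forall w, 0 <= h (pos w)) -> (forall w, h (pos w) = 0 -> f (pos w) = 0) ->
  hull x -> h x = 0 -> f x = 0.
Proof.
move=> ha fa h0 f0 Kx hx; apply/le_anti; rewrite -oppr_ge0.
rewrite (hull_face_ge0 ha (affineN fa) h0 _ Kx hx) => [|w /f0 ->]; last first.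
  by rewrite oppr0.
by rewrite (hull_face_ge0 ha fa h0 _ Kx hx) // => w /f0 ->.
Qed.

End Hull.
End Affine.

(** * Colourings *)

Lemma colorable_of_sees (R : realType) (d : nat) (X : set 'rV[R]_d)
    (C : finType) (c : 'rV[R]_d -> C) :
  (forall x y, X x -> X y -> c x = c y -> sees X x y) ->
  colorable (@invisibility_graph R d X) #|C|.
Proof.
move=> cP; exists (fun x => enum_rank (c (set_val x))) => x y nxy.
move=> /enum_rank_inj cxy; apply: nxy; apply: cP => //; exact: set_valP.
Qed.

Section OddSign.
Context {R : realType}.
Implicit Types (a b c s : R).

(** On the plane a + b + c = 0, a function with values 1 and -1 outside the
    origin that changes its sign under every negative homothety, and takes the
    value 1 at the multiples by positive numbers of (2, -1, -1), (-1, 2, -1) and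
    (-1, -1, 2), the directions of the vertices of a triangle seen from its
    centre.  The sign of abc has these properties except on the three lines where
    it vanishes, on which one of the coordinates decides. *)
Definition odd_sign a b c : R :=
  if a * b * c != 0 then Num.sg (a * b * c)
  else if a != 0 then Num.sg a else Num.sg b.

Lemma odd_sign_scale s a b c :
  s < 0 -> odd_sign (s * a) (s * b) (s * c) = - odd_sign a b c.
Proof.
move=> s0; rewrite /odd_sign.
have -> : s * a * (s * b) * (s * c) = s ^+ 3 * (a * b * c) by ring.
move: (s ^+ 3) (exprn_odd_lt0 s (isT : odd 3)) => s'; rewrite s0 => s3.
move: (a * b * c) => p; rewrite !mulf_eq0 (lt_eqF s3) (lt_eqF s0) !sgrM.
rewrite (ltr0_sg s0) (ltr0_sg s3) /=.
by case: ifP => _; [|case: ifP => _]; rewrite !mulN1r.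
Qed.

Lemma odd_sign_neq0 a b c :
  a + b + c = 0 -> a != 0 \/ b != 0 -> odd_sign a b c != 0.
Proof.
move=> abc ab; rewrite /odd_sign.
case: ifP => [?|_]; first by rewrite sgr_eq0.
have [a0|a0] := eqVneq a 0; last by rewrite /= sgr_eq0.
by case: ab; rewrite ?a0 ?eqxx // sgr_eq0.
Qed.

End OddSign.

(** * Triangular faces with the Ramsey property *)

(** What the two constructions need from the lifted lines: finitely many points,
    and triples of them such that [height L] is an affine function supporting the
    hull along the triangle of L, and the [lagrange L i] are affine functions
    that restrict to the barycentric coordinates of this triangle.  The bound 1
    in [height_off] is a normalisation. *)
Record exposed_triples (R : realType) (d : nat) := ExposedTriples {
  point : finType;
  triple : finType;
  pos : point -> 'rV[R]_d;
  vtx : triple -> 'I_3 -> point;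
  centre : point;
  height : triple -> 'rV[R]_d -> R;
  lagrange : triple -> 'I_3 -> 'rV[R]_d -> R;
  affine_height : forall L, affine (height L);
  affine_lagrange : forall L i, affine (lagrange L i);
  height_vtx : forall L i, height L (pos (vtx L i)) = 0;
  height_off : forall L w, (forall i, w <> vtx L i) -> 1 <= height L (pos w);
  lagrange_vtx : forall L i j, lagrange L i (pos (vtx L j)) = (i == j)%:R;
  vtx_common : forall L L' i i' j j', L <> L' ->
    vtx L i = vtx L' i' -> vtx L j = vtx L' j' -> i = j;
  centre_off : forall L i, centre <> vtx L i
}.

Section Triples.
Context {R : realType} {d : nat} (E : exposed_triples R d).
Implicit Types (L : triple E) (w : point E) (i j k : 'I_3) (x y : 'rV[R]_d).

Local Notation K := (hull (@pos _ _ E)).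

Definition ramsey (g : nat) : Prop :=
  forall c : point E -> 'I_g, exists L, forall i j, c (vtx L i) = c (vtx L j).

(** The point of the triangle of L that no convex piece may contain. *)
Definition hole L := barycentre3 (fun i => pos (vtx L i)).

Lemma height_cases L w :
  (exists i, w = vtx L i) \/ 1 <= height L (pos w).
Proof.
have [[i wi]|nw] := pselect (exists i, w = vtx L i); first by left; exists i.
by right; apply: height_off => i wi; apply: nw; exists i.
Qed.

Lemma height_ge0 L w : 0 <= height L (pos w).
Proof.
case: (height_cases L w) => [[i ->]|]; first by rewrite height_vtx.
exact: le_trans.
Qed.

Lemma height_eq0 L w : height L (pos w) = 0 -> exists i, w = vtx L i.
Proof. by case: (height_cases L w) => // + h0; rewrite h0 ler10. Qed.

Lemma hull_height_ge0 L x : K x -> 0 <= height L x.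
Proof. by apply; [exact: affine_height|exact: height_ge0]. Qed.

Lemma height_hole L : height L (hole L) = 0.
Proof.
rewrite affine_barycentre3; last exact: affine_height.
by rewrite big1 ?mulr0 // => i _; rewrite height_vtx.
Qed.

Lemma lagrange_hole L i : lagrange L i (hole L) = 3^-1.
Proof.
rewrite affine_barycentre3; last exact: affine_lagrange.
rewrite (bigD1 i) //= big1 ?lagrange_vtx ?eqxx ?addr0 ?mulr1 // => j ij.
by rewrite lagrange_vtx eq_sym (negbTE ij).
Qed.

(** A cover by convex sets is a colouring of the points, and a monochromatic
    triple brings its barycentre into one of these sets. *)
Lemma convexity_number_ge g (X : set 'rV[R]_d) :
  ramsey g -> (forall w, X (pos w)) -> (forall L, ~ X (hole L)) ->
  (g%:R%:E <= convexity_number X)%E.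
Proof.
move=> ram Xpos Xhole; apply: enat_min_ge => n [F [FX Fc FU]].
rewrite leqNgt; apply/negP => ltng.
have /choice[c cP] : forall w : point E, exists m, F m (pos w).
  by move=> w; have := Xpos w; rewrite -FU => -[m _]; exists m.
have [L Lmono] := ram (fun w => widen_ord (ltnW ltng) (c w)).
apply: (Xhole L); apply: (FX (c (vtx L ord0))).
apply: barycentre3_convex => // i.
suff -> : c (vtx L ord0) = c (vtx L i) by [].
by have /(congr1 val) := Lmono ord0 i => /= /val_inj.
Qed.

Lemma vertex_not_hole L w : pos w <> hole L.
Proof.
move=> wL; have : height L (pos w) = 0 by rewrite wL height_hole.
move=> /height_eq0[i wi]; have := lagrange_vtx L i i; rewrite -wi wL.
by rewrite lagrange_hole eqxx /=; lra.
Qed.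

(** * The punctured hull *)

Definition punctured : set 'rV[R]_d := K `&` [set x | forall L, x <> hole L].

Lemma pos_punctured w : punctured (pos w).
Proof. by split=> [|L]; [exact: pos_hull|exact: vertex_not_hole]. Qed.

Lemma centre_height L : 1 <= height L (pos (centre E)).
Proof. by apply: height_off => i; exact: centre_off. Qed.

Lemma mix_hull x y t : K x -> K y -> 0 <= t -> t <= 1 ->
  K (t *: x + (1 - t) *: y).
Proof.
move=> Kx Ky; have /convex_setE Kc := @hull_convex _ _ _ (@pos _ _ E).
by have /seesE := Kc _ _ Kx Ky; apply.
Qed.

(** A hole can block the view only between two points of its own face. *)
Lemma hole_mix L x y t : punctured x -> punctured y -> 0 <= t -> t <= 1 ->
  t *: x + (1 - t) *: y = hole L ->
  [/\ 0 < t, t < 1, height L x = 0 & height L y = 0].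
Proof.
move=> [Kx Xx] [Ky Xy] t0 t1 xyL.
have tn0 : t != 0.
  apply: contra_notN (Xy L) => /eqP t0'; move: xyL.
  by rewrite t0' subr0 scale0r scale1r add0r.
have tn1 : t != 1.
  apply: contra_notN (Xx L) => /eqP t1'; move: xyL.
  by rewrite t1' subrr scale0r scale1r addr0.
have lt0t : 0 < t by rewrite lt_def tn0.
have ltt1 : t < 1 by rewrite lt_def eq_sym tn1.
have := height_hole L; rewrite -xyL affine_mix; last exact: affine_height.
have hx := hull_height_ge0 L Kx; have hy := hull_height_ge0 L Ky.
move/eqP; rewrite paddr_eq0 ?mulr_ge0 ?subr_ge0 //.
rewrite !mulf_eq0 (gt_eqF lt0t) subr_eq0 (gt_eqF ltt1) /=.
by move=> /andP[/eqP ? /eqP ?].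
Qed.

Lemma punctured_star_shaped : star_shaped punctured.
Proof.
exists (pos (centre E)); first exact: pos_punctured.
move=> y Xy _; apply/seesE => t t0 t1; split.
  by case: Xy => Ky _; apply: mix_hull => //; exact: pos_hull.
move=> L xyL; have [_ _ hc _] := hole_mix (pos_punctured _) Xy t0 t1 xyL.
by have := centre_height L; rewrite hc ler10.
Qed.

Definition side L x :=
  odd_sign (lagrange L o0 x - 3^-1) (lagrange L o1 x - 3^-1)
    (lagrange L o2 x - 3^-1).

Lemma face_sum L x : K x -> height L x = 0 -> \sum_i lagrange L i x = 1.
Proof.
move=> Kx hx; apply/eqP; rewrite -subr_eq0; apply/eqP.
apply: (hull_face_eq0 (h := height L)
  (f := fun x => \sum_i lagrange L i x - 1)) Kx hx.
- exact: affine_height.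
- apply: affineB (affine_cst 1); apply: affine_sum => i.
  exact: affine_lagrange.
- exact: height_ge0.
- move=> w /height_eq0[i ->]; rewrite (bigD1 i) //= lagrange_vtx eqxx.
  rewrite big1 ?addr0 ?subrr // => j ij.
  by rewrite lagrange_vtx (negbTE ij).
Qed.

Lemma face_interpolation L x : K x -> height L x = 0 ->
  x = \sum_i lagrange L i x *: pos (vtx L i).
Proof.
move=> Kx hx; apply/rowP => k; apply/eqP; rewrite -subr_eq0 summxE; apply/eqP.
under eq_bigr do rewrite mxE mulrC.
apply: (hull_face_eq0 (h := height L)
  (f := fun x => x 0 k - \sum_i pos (vtx L i) 0 k * lagrange L i x)) Kx hx.
- exact: affine_height.
- apply: affineB; first exact: affine_coord.
  by apply: affine_sum => i; apply: affineZ; exact: affine_lagrange.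
- exact: height_ge0.
- move=> w /height_eq0[i ->]; rewrite (bigD1 i) //= lagrange_vtx eqxx mulr1.
  rewrite big1 ?addr0 ?subrr // => j ij.
  by rewrite lagrange_vtx (negbTE ij) mulr0.
Qed.

Lemma side_neq0 L x : punctured x -> height L x = 0 -> side L x != 0.
Proof.
move=> [Kx Xx] hx; have := face_sum Kx hx; rewrite sum3 => s1.
apply: odd_sign_neq0; first by lra.
apply/orP; rewrite -negb_and.
apply: contra_notN (Xx L) => /andP[/eqP d0 /eqP d1].
rewrite (face_interpolation Kx hx) /hole /barycentre3 scaler_sumr.
by apply: eq_bigr => i _; congr (_ *: _); elim/letterP: i; lra.
Qed.

(** A point of two faces is a common vertex: the sum of the two heights supports
    the hull along the intersection of the two triples. *)
Lemma two_faces L L' x : L <> L' -> K x -> height L x = 0 -> height L' x = 0 ->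
  exists j, forall k, lagrange L' k x = (k == j)%:R.
Proof.
move=> LL' Kx hx hx'; pose h x := height L x + height L' x.
have ha : affine h by apply: affineD; exact: affine_height.
have h0 w : 0 <= h (pos w) by rewrite addr_ge0 ?height_ge0.
have hxx : h x = 0 by rewrite /h hx hx' addr0.
have common w : h (pos w) = 0 -> exists i j, w = vtx L i /\ w = vtx L' j.
  move/eqP; rewrite paddr_eq0 ?height_ge0 // => /andP[/eqP /height_eq0[i wi]].
  by move=> /eqP /height_eq0[j wj]; exists i, j.
have [[i [j vij]]|no] := pselect (exists i j, vtx L i = vtx L' j).
  exists j => k; apply/eqP; rewrite -subr_eq0; apply/eqP.
  apply: (hull_face_eq0 ha (f := fun x => lagrange L' k x - _)) Kx hxx => //.
    by apply: affineB (affine_cst _); exact: affine_lagrange.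
  move=> w /common[i' [j' [wi' wj']]].
  have -> : w = vtx L' j.
    by rewrite wi' (vtx_common LL' (etrans (esym wi') wj') vij).
  by rewrite lagrange_vtx subrr.
suff : 0 <= (-1 : R) by rewrite oppr_ge0 ler10.
apply: (hull_face_ge0 ha (affine_cst (-1)) h0 _ Kx hxx) => w.
move=> /common[i [j [wi wj]]]; case: no; exists i, j; by rewrite -wi.
Qed.

Lemma side_two_faces L L' x : L <> L' -> K x -> height L x = 0 ->
  height L' x = 0 -> 0 < side L' x.
Proof.
move=> LL' Kx hx hx'; have [j xj] := two_faces LL' Kx hx hx'.
rewrite /side !xj /odd_sign; elim/letterP: j {xj} => /=.
all: set p := (X in X != 0).
all: have p0 : 0 < p by rewrite /p; lra.
all: by rewrite gt_eqF //= sgr_gt0.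
Qed.

Definition negative_side x := `[< exists L, height L x = 0 /\ side L x < 0 >].

(** The colour [negative_side] can be read on any face that contains x: if there
    are several, x is a vertex, and every side is positive. *)
Lemma negative_sideE L x : punctured x -> height L x = 0 ->
  negative_side x = (side L x < 0).
Proof.
move=> [Kx _] hx; apply/asboolP/idP => [[L' [hx' sx']]|sx]; last by exists L.
have [->//|/eqP LL'] := eqVneq L L'.
by have := side_two_faces LL' Kx hx hx'; rewrite ltNge (ltW sx').
Qed.

Lemma hole_mix_side L x y t : punctured x -> punctured y -> 0 <= t -> t <= 1 ->
  t *: x + (1 - t) *: y = hole L -> side L y = - side L x.
Proof.
move=> Xx Xy t0 t1 xyL; have [lt0t ltt1 hx hy] := hole_mix Xx Xy t0 t1 xyL.
have t'0 : 1 - t != 0 by rewrite subr_eq0 gt_eqF.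
have dE k : lagrange L k y - 3^-1 = - (t / (1 - t)) * (lagrange L k x - 3^-1).
  have := lagrange_hole L k.
  rewrite -xyL affine_mix; last exact: affine_lagrange.
  move=> e; apply: (mulIf t'0); rewrite mulrAC mulNr divfK //; lra.
rewrite /side !dE odd_sign_scale // oppr_lt0 divr_gt0 // subr_gt0 //.
Qed.

Lemma punctured_colorable : colorable (@invisibility_graph _ _ punctured) 2.
Proof.
rewrite -card_bool; apply: (colorable_of_sees (c := negative_side)).
move=> x y Xx Xy cxy; apply/seesE => t t0 t1.
split; first by case: Xx Xy => Kx _ [Ky _]; exact: mix_hull.
move=> L xyL; have [_ _ hx hy] := hole_mix Xx Xy t0 t1 xyL.
move: cxy (side_neq0 Xx hx); rewrite !(negative_sideE (L := L)) //.
by rewrite (hole_mix_side Xx Xy t0 t1 xyL) oppr_lt0; case: ltgtP.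
Qed.

(** With fewer than two colours all the points would see each other; the
    punctured hull would then be convex and contain its holes. *)
Lemma chi_punctured (g : nat) : (0 < g)%N -> ramsey g -> chi punctured = 2%:E.
Proof.
move=> g0 ram; apply/le_anti.
rewrite enat_min_le; last exact: punctured_colorable.
apply: enat_min_ge => n [c cP]; rewrite leqNgt; apply/negP => ltn2.
have [L _] := ram (fun=> Ordinal g0).
suff : punctured (hole L) by case=> _; apply.
apply: barycentre3_convex => [|i]; last exact: pos_punctured.
apply/convex_setE => x y Xx Xy; apply: contrapT => nxy.
apply: (cP (SigSub (mem_set Xx)) (SigSub (mem_set Xy))) => //.
case: (c _) (c _) => [i lti] [j ltj]; apply: val_inj => /=; lia.
Qed.

(** * The dented hull *)

Lemma lagrange_bounded :
  exists2 B : R, 1 <= B & forall L i w, lagrange L i (pos w) <= B.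
Proof.
pose F (p : triple E * 'I_3 * point E) := `|lagrange p.1.1 p.1.2 (pos p.2)|.
exists (1 + \sum_p F p) => [|L i w].
  by rewrite lerDl sumr_ge0 // => p _; exact: normr_ge0.
rewrite (bigD1 (L, i, w)) //= /F /=.
have := ler_norm (lagrange L i (pos w)).
have : 0 <= \sum_(p | p != (L, i, w)) F p.
  by rewrite sumr_ge0 // => p _; exact: normr_ge0.
rewrite /F; lra.
Qed.

Section Dents.
Context (B : R) (B_ge1 : 1 <= B).
Context (lagrange_le : forall L i w, lagrange L i (pos w) <= B).

Let B_gt0 : 0 < B.
Proof. exact: lt_le_trans ltr01 B_ge1. Qed.

(** The dent of L is where the three functions [dent L i] are positive.  The slope
    [8 * B ^+ 2] makes it so shallow that it stays below the height 1 / (8 * B);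
    this height is in turn so small that the points below it above two faces
    have almost the barycentric coordinates of a common vertex. *)
Definition dent L i x :=
  lagrange L i x - 4^-1 - 8 * B ^+ 2 * height L x.

Definition dented : set 'rV[R]_d :=
  K `&` [set x | forall L, exists i, dent L i x <= 0].

Lemma affine_dent L i : affine (dent L i).
Proof.
apply: affineB; last by apply: affineZ; exact: affine_height.
by apply: affineB (affine_cst _); exact: affine_lagrange.
Qed.

Lemma dented_closed : closed dented.
Proof.
rewrite (_ : dented = K `&` \bigcap_L (\bigcup_i [set x | 0 <= - dent L i x])).
  apply: closedI; first exact: hull_closed.
  apply: closed_bigI => L _; apply: closed_bigcup; first exact: finite_finset.
  by move=> i _; apply/closed_affine_ge0/affineN/affine_dent.
apply/seteqP; split=> x [Kx Xx]; split=> // L.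
  by move=> _; have [i xi] := Xx L; exists i => //=; rewrite oppr_ge0.
by have [//|i _ /=] := Xx L; rewrite oppr_ge0; exists i.
Qed.

(** A dent blocks the view between x and y only if its three functions
    separate them: no half-space [dent L i <= 0] contains both. *)
Lemma dented_sees x y : K x -> K y ->
  (forall L, exists i, dent L i x <= 0 /\ dent L i y <= 0) ->
  sees dented x y.
Proof.
move=> Kx Ky xy; apply/seesE => t t0 t1; split; first exact: mix_hull.
move=> L; have [i [xi yi]] := xy L; exists i.
rewrite affine_mix; last exact: affine_dent.
have t1' : 0 <= 1 - t by rewrite subr_ge0.
by have := mulr_ge0_le0 t0 xi; have := mulr_ge0_le0 t1' yi; lra.
Qed.

Lemma dent_high L i x : K x -> 1 <= 8 * B * height L x -> dent L i x <= 0.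
Proof.
move=> Kx hx; rewrite /dent.
have lB : lagrange L i x <= B.
  by apply: (hull_le _ (affine_cst B)) Kx; [exact: affine_lagrange|].
have : B * 1 <= B * (8 * B * height L x) by rewrite ler_pM2l.
have -> : B * (8 * B * height L x) = 8 * B ^+ 2 * height L x by ring.
lra.
Qed.

(** Low above two faces, a point is close to a vertex, the j-th of L say, hence
    its other barycentric coordinates are at most 1/4.  Indeed, outside of the
    common vertex one of the two heights is at least 1, so B times their sum
    bounds these coordinates. *)
Lemma dent_two_layers L L' x : L <> L' -> K x ->
  8 * B * height L x < 1 -> 8 * B * height L' x < 1 ->
  exists j, forall i, i != j -> dent L i x <= 0.
Proof.
move=> LL' Kx hx hx'.
have [j jP] : exists j, forall i w, i != j ->
    lagrange L i (pos w) <= B * (height L (pos w) + height L' (pos w)).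
  have off i w : (1 <= height L (pos w)) || (1 <= height L' (pos w)) ->
      lagrange L i (pos w) <= B * (height L (pos w) + height L' (pos w)).
    move=> hw; apply: le_trans (lagrange_le L i w) _.
    rewrite -[leLHS]mulr1 ler_pM2l //.
    have := height_ge0 L w; have := height_ge0 L' w.
    by case/orP: hw; lra.
  have [[j [j' vj]]|no] := pselect (exists j j', vtx L j = vtx L' j').
    exists j => i w ij; case: (height_cases L w) => [[k wk]|h]; last first.
      by apply: off; rewrite h.
    case: (height_cases L' w) => [[k' wk']|h]; last first.
      by apply: off; rewrite h orbT.
    have kj : k = j by apply: (vtx_common LL' _ vj); rewrite -wk wk'.
    rewrite {1}wk kj lagrange_vtx (negbTE ij).
    by rewrite mulr_ge0 ?(ltW B_gt0) ?addr_ge0 ?height_ge0.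
  exists ord0 => i w _; apply: off.
  case: (height_cases L w) => [[k wk]|-> //].
  case: (height_cases L' w) => [[k' wk']|->]; last by rewrite orbT.
  by case: no; exists k, k'; rewrite -wk.
exists j => i ij.
have hL := hull_height_ge0 L Kx.
have ga : affine (fun x => B * (height L x + height L' x)).
  by apply/affineZ/affineD; exact: affine_height.
have := hull_le (affine_lagrange L i) ga (fun w => jP i w ij) Kx.
have : 0 <= B ^+ 2 * height L x by rewrite mulr_ge0 ?sqr_ge0.
rewrite /dent; lra.
Qed.

Lemma pos_dented w : dented (pos w).
Proof.
split=> [|L]; first exact: pos_hull.
case: (height_cases L w) => [[i ->]|hw].
  (* Any index other than i works: that coordinate vanishes at the vertex. *)
  exists (if i == o0 then o1 else o0); rewrite /dent lagrange_vtx height_vtx.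
  by elim/letterP: i => /=; lra.
exists ord0; apply: dent_high; first exact: pos_hull.
have : 1 * 1 <= B * height L (pos w) by apply: ler_pM.
lra.
Qed.

Lemma hole_not_dented L : ~ dented (hole L).
Proof.
case=> _ /(_ L)[i]; rewrite /dent lagrange_hole height_hole; lra.
Qed.

Lemma dented_star_shaped : star_shaped dented.
Proof.
exists (pos (centre E)); first exact: pos_dented.
move=> y [Ky Xy] _; apply: dented_sees => //.
move=> L; have [i yi] := Xy L; exists i; split=> //.
apply: dent_high; first exact: pos_hull.
have : 1 * 1 <= B * height L (pos (centre E)).
  by apply: ler_pM => //; exact: centre_height.
lra.
Qed.

(** The bound of [dent_two_layers] extends to every face J: either x is high above
    J, or one of L and L' is a second face above which x is low. *)
Lemma dent_near_vertex L L' x : L <> L' -> K x ->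
  8 * B * height L x < 1 -> 8 * B * height L' x < 1 ->
  forall J, exists j, forall i, i != j -> dent J i x <= 0.
Proof.
move=> LL' Kx hx hx' J.
have [hJ|hJ] := leP 1 (8 * B * height J x).
  by exists ord0 => i _; exact: dent_high.
have [JL|/eqP JL] := eqVneq J L.
  by apply: (dent_two_layers _ Kx hJ hx'); rewrite JL.
exact: dent_two_layers JL Kx hJ hx.
Qed.

(** The colouring of the dented hull; the value [None] is the colour of the points
    near the vertices. *)
Definition clear_side x : option 'I_3 :=
  [pick i | `[< forall L, dent L i x <= 0 >]].

Lemma clear_side_Some x i L : clear_side x = Some i -> dent L i x <= 0.
Proof. by rewrite /clear_side; case: pickP => // j /asboolP xj [<-]. Qed.

(** A point outside of the dents that is low above at most one face has a clear
    side: the side by which it avoids the dent of this face. *)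
Lemma clear_side_None x : dented x -> clear_side x = None ->
  forall J, exists j, forall i, i != j -> dent J i x <= 0.
Proof.
move=> [Kx Xx]; rewrite /clear_side; case: pickP => // noside _.
have low i : exists2 L, 8 * B * height L x < 1 & 0 < dent L i x.
  have [[L iL]|no] := pselect (exists L, 0 < dent L i x).
    exists L => //; rewrite ltNge; apply/negP => hL.
    by have := dent_high i Kx hL; rewrite leNgt iL.
  have /asboolP[] := noside i => L; rewrite leNgt; apply/negP => iL.
  by apply: no; exists L.
have [L hL _] := low o0; have [i iL] := Xx L.
have [L' hL' iL'] := low i.
apply: (dent_near_vertex _ Kx hL hL') => LL'.
by move: iL'; rewrite -LL' ltNge iL.
Qed.

(** Two points near vertices see each other past every dent because each of them
    excludes at most one of the three indices. *)
Lemma dented_colorable : colorable (@invisibility_graph _ _ dented) 4.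
Proof.
have -> : 4%N = #|{: option 'I_3}| by rewrite card_option card_ord.
apply: (colorable_of_sees (c := clear_side)) => x y Xx Xy cxy.
have [Kx _] := Xx; have [Ky _] := Xy; apply: dented_sees => // L.
case cx : (clear_side x) cxy => [i|] /esym cy.
  by exists i; split; exact: clear_side_Some.
have [j xj] := clear_side_None Xx cx L; have [k yk] := clear_side_None Xy cy L.
have [i ij ik] : exists2 i : 'I_3, i != j & i != k.
  by elim/letterP: j {xj}; elim/letterP: k {yk};
    solve [by exists o0 | by exists o1 | by exists o2].
by exists i; split; [exact: xj|exact: yk].
Qed.

End Dents.
End Triples.

(** * Combinatorial lines in the plane *)

(** Uniqueness of the digits in base M, for signed digits below M. *)
Lemma digits_eq0 m (M : int) (c : 'I_m -> int) :
  (forall k, `|c k| < M) -> \sum_k c k * M ^+ k = 0 -> forall k, c k = 0.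
Proof.
elim: m c => [|m IH] c cM; first by move=> _ [].
rewrite big_ord_recl expr0 mulr1.
under eq_bigr do rewrite exprS mulrCA.
rewrite -mulr_sumr => sum0.
have c0 : c ord0 = 0.
  apply/eqP; rewrite -absz_eq0; apply: contraTT (cM ord0) => c0.
  have : (`|M| %| `|c ord0|)%N.
    rewrite -dvdzE; apply/dvdzP.
    exists (- \sum_(i < m) c (lift ord0 i) * M ^+ i).
    by move/eqP: sum0; rewrite addr_eq0 => /eqP ->; ring.
  by move=> /dvdn_leq; lia.
move: sum0; rewrite c0 add0r => /eqP; rewrite mulf_eq0.
have -> /= : (M == 0) = false by have := cM ord0; lia.
move=> /eqP /IH cl k; case: (unliftP ord0 k) => [j ->|-> //].
by apply: cl => i.
Qed.

Section Templates.
Context {n : nat}.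
Local Notation word := (n.-tuple 'I_3).
Local Notation template := {t : n.-tuple (option 'I_3) | None \in t}.
Implicit Types (w : word) (t : template) (M : int).

Definition subst_star t (x : 'I_3) : word := map_tuple (odflt x) (val t).

Definition star t (i : 'I_n) : int := (tnth (val t) i == None)%:R.

Lemma star01 t i : star t i = 0 \/ star t i = 1.
Proof. by rewrite /star; case: eqP; [right|left]. Qed.

Lemma has_star t : exists i, tnth (val t) i = None.
Proof. by have /tnthP[i] := valP t; exists i. Qed.

Lemma subst_star_inj t : injective (subst_star t).
Proof.
move=> x y /(congr1 (fun w => tnth w _)) xy; have [i ti] := has_star t.
by have := xy i; rewrite !tnth_map ti.
Qed.

(** Two words of a combinatorial line determine it: the stars are where they
    differ. *)
Lemma two_words_template t t' x x' y y' : t <> t' ->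
  subst_star t x = subst_star t' x' -> subst_star t y = subst_star t' y' ->
  x = y.
Proof.
move=> tt' ex ey; apply: contrapT => xy; apply: tt'.
have xy' : x' <> y' by move=> e; apply/xy/(@subst_star_inj t); rewrite ex ey e.
apply/val_inj/eq_from_tnth => i.
have := congr1 (fun w => tnth w i) ex; have := congr1 (fun w => tnth w i) ey.
rewrite !tnth_map; case: (tnth (val t) i) (tnth (val t') i) => [a|] [b|] //=.
- by move=> ->.
- by move=> -> /esym /xy'.
- by move=> <- /xy.
Qed.

Definition digit w (i : 'I_n) : int := (val (tnth w i))%:Z.

(** Words are placed in the plane by reading them as numbers in two bases; a
    combinatorial line goes to a geometric line of direction
    [(step M t, step M' t)]. *)
Definition reading M w : int := \sum_i digit w i * M ^+ i.

Definition step M t : int := \sum_i star t i * M ^+ i.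

Lemma digit_subst_star t x i :
  digit (subst_star t x) i = digit (subst_star t o0) i + (val x)%:Z * star t i.
Proof.
by rewrite /digit /star !tnth_map; case: (tnth (val t) i) => [a|] /=; lia.
Qed.

Lemma reading_subst_star M t x :
  reading M (subst_star t x) =
  reading M (subst_star t o0) + (val x)%:Z * step M t.
Proof.
rewrite /reading /step mulr_sumr -big_split; apply: eq_bigr => i _ /=.
by rewrite digit_subst_star; ring.
Qed.

Lemma step_gt0 M t : 0 < M -> 0 < step M t.
Proof.
move=> M0; have [i ti] := has_star t.
rewrite /step (bigD1 i) //= {1}/star ti eqxx mul1r ltr_wpDr ?exprn_gt0 //.
by rewrite sumr_ge0 // => j _; rewrite mulr_ge0 ?exprn_ge0 // ltW.
Qed.

(** The second base, chosen to exceed every number whose digits in base 5 are at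
    most 4 in absolute value. *)
Definition base : int := 4 * (\sum_(i < n) 5 ^+ i) + 1.

(** The equation of the geometric line spanned by t, as a determinant. *)
Definition line_form t w : int :=
  step 5 t * (reading base w - reading base (subst_star t o0)) -
  step base t * (reading 5 w - reading 5 (subst_star t o0)).

Lemma line_form_subst_star t x : line_form t (subst_star t x) = 0.
Proof. by rewrite /line_form !(reading_subst_star _ _ x); ring. Qed.

(** No accidental incidences: a word on the geometric line of t belongs to the
    combinatorial line of t.  If u is the difference of w and the first word of t,
    the determinant is, with s the indicator of the stars, the number with digits
    s_i u_j - s_j u_i in the double base (5, [base]).  These digits are at most 4
    in absolute value, so they all vanish, and u is proportional to s. *)
Lemma line_form_eq0 t w : line_form t w = 0 -> exists x, w = subst_star t x.
Proof.
pose u i := digit w i - digit (subst_star t o0) i.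
pose c i j := star t i * u j - star t j * u i.
have c4 i j : `|c i j| <= 4.
  have d3 v k : 0 <= digit v k <= 2.
    by rewrite /digit; case: (tnth v k) => m /=; lia.
  have := d3 w i; have := d3 w j.
  have := d3 (subst_star t o0) i; have := d3 (subst_star t o0) j.
  by rewrite /c /u; case: (star01 t i) => ->; case: (star01 t j) => ->; lia.
have -> : line_form t w = \sum_j (\sum_i c i j * 5 ^+ i) * base ^+ j.
  have readingB M :
      reading M w - reading M (subst_star t o0) = \sum_i u i * M ^+ i.
    by rewrite /reading -sumrB; apply: eq_bigr => i _; rewrite -mulrBl.
  rewrite /line_form !readingB /step mulrC [X in _ - X]mulrC.
  rewrite [X in _ - X]mulrC !mulr_suml -sumrB; apply: eq_bigr => j _.
  rewrite -!mulrA ![base ^+ j * _]mulrC !mulrA -mulrBl !mulr_sumr -sumrB.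
  by congr (_ * _); apply: eq_bigr => i _; rewrite /c; ring.
move=> /digits_eq0 inner0.
have {}inner0 j : \sum_i c i j * 5 ^+ i = 0.
  apply: inner0 => k; apply: (@le_lt_trans _ _ (4 * \sum_(i < n) 5 ^+ i)).
    rewrite mulr_sumr; apply: le_trans (ler_norm_sum _ _ _) _.
    apply: ler_sum => i _; rewrite normrM [X in _ * X]ger0_norm ?exprn_ge0 //.
    by rewrite ler_wpM2r ?exprn_ge0.
  by rewrite /base ltrDl.
have c0 i j : c i j = 0.
  by apply: (digits_eq0 _ (inner0 j)) => k; have := c4 k j; lia.
have [i ti] := has_star t; exists (tnth w i).
apply: eq_from_tnth => j; apply/val_inj.
have := c0 i j; rewrite /c /u /star ti eqxx /= /digit !tnth_map ti /=.
by case: (tnth (val t) j) => [a|] /=; lia.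
Qed.

(** * The lift to the Veronese surface *)

Section Veronese.
Context {R : realType}.
Implicit Types (a b : R).

Definition veronese a b : 'rV[R]_5 :=
  \row_k [:: a; b; a ^+ 2; a * b; b ^+ 2]`_k.

Definition coord (x : 'rV[R]_5) (k : nat) : R := x 0 (inord k).

(** The affine function on R^5 that becomes, on the Veronese surface, the product
    of two affine forms [(a, b) |-> f.1.1 * a + f.1.2 * b + f.2] of the plane. *)
Definition form_mul (f g : R * R * R) (x : 'rV[R]_5) : R :=
  f.2 * g.2 + (f.1.1 * g.2 + f.2 * g.1.1) * coord x 0
  + (f.1.2 * g.2 + f.2 * g.1.2) * coord x 1 + f.1.1 * g.1.1 * coord x 2
  + (f.1.1 * g.1.2 + f.1.2 * g.1.1) * coord x 3 + f.1.2 * g.1.2 * coord x 4.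

Lemma affine_form_mul f g : affine (form_mul f g).
Proof.
by do 5![apply: affineD; last by apply: affineZ; exact: affine_coord];
  exact: affine_cst.
Qed.

Lemma form_mul_veronese f g a b : form_mul f g (veronese a b) =
  (f.1.1 * a + f.1.2 * b + f.2) * (g.1.1 * a + g.1.2 * b + g.2).
Proof. by rewrite /form_mul /coord !mxE !inordK //=; ring. Qed.

(** On this point the square of an affine form is the sum of the squares of its
    coefficients, hence at least 1 for every integral equation of a line; it serves
    as the centre of the star. *)
Definition apex : 'rV[R]_5 := \row_k [:: 0; 0; 1; 0; 1]`_k.

Lemma form_mul_apex f : form_mul f f apex = f.1.1 ^+ 2 + f.1.2 ^+ 2 + f.2 ^+ 2.
Proof. by rewrite /form_mul /coord !mxE !inordK //=; ring. Qed.

Definition position (o : option word) : 'rV[R]_5 :=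
  if o is Some w then veronese (reading 5 w)%:~R (reading base w)%:~R else apex.

Definition line_coef t : R * R * R :=
  (- (step base t)%:~R, (step 5 t)%:~R,
   (step base t * reading 5 (subst_star t o0)
    - step 5 t * reading base (subst_star t o0))%:~R).

Definition line_height t := form_mul (line_coef t) (line_coef t).

Lemma line_height_Some t w :
  line_height t (position (Some w)) = (line_form t w ^+ 2)%:~R.
Proof.
rewrite /line_height form_mul_veronese /= -expr2 rmorphXn; congr (_ ^+ 2).
by rewrite /line_form !rmorphB !rmorphM !rmorphB /=; ring.
Qed.

Lemma line_height_subst_star t x :
  line_height t (position (Some (subst_star t x))) = 0.
Proof. by rewrite line_height_Some line_form_subst_star. Qed.

Lemma line_height_off t o : (forall x, o <> Some (subst_star t x)) ->
  1 <= line_height t (position o).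
Proof.
case: o => [w|] ow.
  rewrite line_height_Some -[1]/(1%:~R) ler_int.
  have : line_form t w != 0.
    by apply/eqP => /line_form_eq0[x wx]; apply: (ow x); rewrite wx.
  by rewrite expr2; nia.
rewrite /line_height /= form_mul_apex /=.
have : 1 <= ((step 5 t)%:~R : R).
  by rewrite -[1]/(1%:~R) ler_int; exact: step_gt0.
move=> s1; have := sqr_ge0 (line_coef t).1.1; have := sqr_ge0 (line_coef t).2.
rewrite /=; nra.
Qed.

(** The affine form whose values at the three points of the line of t are 0, 1
    and 2; the [interpolant t i] are the Lagrange polynomials in it. *)
Definition param_coef t : R * R * R :=
  ((step 5 t)%:~R^-1, 0,
   - (reading 5 (subst_star t o0))%:~R / (step 5 t)%:~R).

Definition interpolant t (i : 'I_3) : 'rV[R]_5 -> R :=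
  let: (a, _, c) := param_coef t in
  match val i with
  | 0%N => form_mul (- a, 0, 1 - c) (- a / 2, 0, 1 - c / 2)
  | 1%N => form_mul (a, 0, c) (- a, 0, 2 - c)
  | _ => form_mul (a / 2, 0, c / 2) (a, 0, c - 1)
  end.

Lemma affine_interpolant t i : affine (interpolant t i).
Proof. by elim/letterP: i; exact: affine_form_mul. Qed.

Lemma interpolant_subst_star t i j :
  interpolant t i (position (Some (subst_star t j))) = (i == j)%:R.
Proof.
have s0 : ((step 5 t)%:~R : R) != 0 by rewrite intr_eq0 gt_eqF // step_gt0.
rewrite /interpolant /= (reading_subst_star _ _ j) rmorphD rmorphM /=.
by elim/letterP: i; elim/letterP: j; rewrite /= form_mul_veronese /=; field.
Qed.

Definition lines_on_veronese : exposed_triples R 5.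
Proof.
refine (@ExposedTriples R 5 (option word) template position
  (fun t x => Some (subst_star t x)) None line_height interpolant
  _ affine_interpolant line_height_subst_star line_height_off
  interpolant_subst_star _ _).
- by move=> t; exact: affine_form_mul.
- move=> t t' i i' j j' tt' /Some_inj ei /Some_inj ej.
  exact: two_words_template tt' ei ej.
- by [].
Defined.

End Veronese.
End Templates.

Lemma lines_on_veronese_ramsey (R : realType) (g : nat) :
  exists n, ramsey (@lines_on_veronese n R) g.
Proof.
have [n HJn] := hales_jewett3 'I_g.
exists n => c.
have [t [/eqP szt Nt tc]] :=
  HJn (fun s => c (Some [tuple nth ord0 s i | i < n])).
exists (exist _ (Tuple szt) Nt) => i j /=.
have E x : subst_star (exist _ (Tuple szt) Nt) x
    = [tuple nth ord0 (fill x t) i | i < n].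
  apply: eq_from_tnth => k; rewrite tnth_map tnth_mktuple (tnth_nth None) /=.
  by rewrite (nth_map None) // (eqP szt).
by rewrite !E.
Qed.

Unset Implicit Arguments.

Theorem theorem4 (R : realType) (g : nat) (g_gt0 : (0 < g)%N) :
  (exists X : set 'rV[R]_5,
     [/\ star_shaped X, chi X = 2%:E & (g%:R%:E <= convexity_number X)%E]) /\
  (exists Xc : set 'rV[R]_5,
     [/\ star_shaped Xc, closed Xc, (chi Xc <= 6%:E)%E &
         (g%:R%:E <= convexity_number Xc)%E]).
Proof.
have [n ram] := lines_on_veronese_ramsey R g.
split.
  exists (punctured (@lines_on_veronese n R)); split.
  - exact: punctured_star_shaped.
  - exact: chi_punctured g_gt0 ram.
  - apply: convexity_number_ge ram _ _; first exact: pos_punctured.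
    by move=> L [_ /(_ L)].
have [B B1 lagrangeB] := lagrange_bounded (@lines_on_veronese n R).
exists (dented (@lines_on_veronese n R) B); split.
- exact: dented_star_shaped.
- exact: dented_closed.
- apply: (@le_trans _ _ 4%:R%:E); last by rewrite lee_fin ler_nat.
  by apply: enat_min_le; exact: dented_colorable B1 lagrangeB.
- apply: convexity_number_ge ram _ _; first exact: pos_dented.
  exact: hole_not_dented.
Qed.
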